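(* Let $R$ be a ring whose nilradical $\mathcal{N}(R)$ is a prime ideal. Then there is a multiplicative set $W\subseteq R\setminus\mathcal{N}(R)$ such that $W^{-1}R$ is unit-additive, and such that for any ring homomorphism $\varphi:R\to S$, where $S$ is unit-additive and $\varphi^{-1}(\mathcal{N}(S))\subseteq\mathcal{N}(R)$, there is a unique ring homomorphism $\tilde\varphi:W^{-1}R\to S$ such that $\tilde\varphi\circ\ell=\varphi$, where $\ell:R\to W^{-1}R$ is the localization map.
   Context: All rings are commutative and unital. $\mathcal{N}(\cdot)$ denotes the nilradical. A ring $R$ is unit-additive if whenever $u,v$ are units of $R$, $u+v$ is either a unit of $R$ or a nilpotent element. *)

(* Defs.v *)
From HB Require Import structures.
From mathcomp Require Import all_boot all_algebra.
From mathcomp Require Import boolp ring.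

Set Implicit Arguments.
Unset Strict Implicit.
Unset Printing Implicit Defensive.

Import GRing.Theory.
Local Open Scope ring_scope.
Local Open Scope quotient_scope.

(* Rings are [comPzRingType]: the zero ring is allowed, so [GRing.unit] and the
   ideals of [ring_quotient], which need a nonzero ring, are not available. *)

Definition is_unit (R : comPzRingType) (x : R) : Prop := exists y, x * y = 1.

Definition nilpotent_elt (R : comPzRingType) (x : R) : Prop :=
  exists n : nat, x ^+ n = 0.

Definition nilradical (R : comPzRingType) : {pred R} :=
  fun x => `[< nilpotent_elt x >].
Arguments nilradical : clear implicits.

Definition ideal (R : comPzRingType) (I : {pred R}) : Prop :=
  0 \in I /\ forall a, {in I &, forall u v, a * u + v \in I}.

Definition prime_ideal (R : comPzRingType) (I : {pred R}) : Prop :=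
  [/\ ideal I, 1 \notin I
    & forall u v, u * v \in I -> (u \in I) || (v \in I)].

Definition unit_additive (R : comPzRingType) : Prop :=
  forall u v : R, is_unit u -> is_unit v ->
    is_unit (u + v) \/ nilpotent_elt (u + v).

Section Localization.

Variables (R : comPzRingType) (W : mulrClosed R).

Definition loc_denom := {w : R | w \in W}.
Definition loc_ratio := (R * loc_denom)%type.

Implicit Types (x y z : loc_ratio).

Definition loc_denom1 : loc_denom := exist _ 1 (rpred1 W).
Definition loc_denomM (u v : loc_denom) : loc_denom :=
  exist _ (val u * val v) (rpredM (valP u) (valP v)).

Definition loc_equiv x y : bool :=
  `[< exists2 w, w \in W & w * (x.1 * val y.2) = w * (y.1 * val x.2) >].

Lemma loc_equiv_refl : reflexive loc_equiv.
Proof. by move=> x; apply/asboolP; exists 1; rewrite ?rpred1. Qed.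

Lemma loc_equiv_sym : symmetric loc_equiv.
Proof. by move=> x y; apply/asboolP/asboolP => -[w Ww e]; exists w. Qed.

Lemma loc_equiv_trans : transitive loc_equiv.
Proof.
move=> [b [t Wt]] [a [s Ws]] [c [u Wu]] /asboolP[/= v Wv e] /asboolP[/= w Ww f].
apply/asboolP; exists (v * w * t) => /=; first by rewrite !rpredM.
have -> : v * w * t * (a * u) = w * u * (v * (a * t)) by ring.
have -> : v * w * t * (c * s) = v * s * (w * (c * t)) by ring.
by rewrite e -f; ring.
Qed.

Canonical loc_equivRel := EquivRel loc_equiv loc_equiv_refl loc_equiv_sym loc_equiv_trans.

Definition localization := {eq_quot loc_equiv}.

HB.instance Definition _ : EqQuotient _ loc_equiv localization := EqQuotient.on localization.
HB.instance Definition _ := Choice.on localization.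

Lemma eq_pi_locP x y :
  \pi_localization x = \pi_localization y <->
  exists2 w, w \in W & w * (x.1 * val y.2) = w * (y.1 * val x.2).
Proof.
split=> [/eqmodP/asboolP //|e].
by apply/eqmodP/asboolP.
Qed.

Lemma repr_pi_locP x :
  exists2 w, w \in W &
    w * ((repr (\pi_localization x)).1 * val x.2) = w * (x.1 * val (repr (\pi_localization x)).2).
Proof. by apply/eq_pi_locP; rewrite reprK. Qed.

Definition ratio_add x y : loc_ratio :=
  (x.1 * val y.2 + y.1 * val x.2, loc_denomM x.2 y.2).
Definition ratio_opp x : loc_ratio := (- x.1, x.2).
Definition ratio_mul x y : loc_ratio := (x.1 * y.1, loc_denomM x.2 y.2).

Definition loc0 : localization := \pi_localization (0, loc_denom1).
Definition loc1 : localization := \pi_localization (1, loc_denom1).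
Definition loc_add := lift_op2 localization ratio_add.
Definition loc_opp := lift_op1 localization ratio_opp.
Definition loc_mul := lift_op2 localization ratio_mul.

Lemma pi_loc_add : {morph \pi_localization : x y / ratio_add x y >-> loc_add x y}.
Proof.
move=> x y; unlock loc_add; apply/eq_pi_locP => /=.
have [v Wv] := repr_pi_locP x; have [w Ww] := repr_pi_locP y.
case: (repr (\pi_localization x)) (repr (\pi_localization y)) => [a' [s' ?]] [b' [t' ?]].
case: x y => [a [s ?]] [b [t ?]] /= f e.
exists (v * w); first exact: rpredM.
transitivity (w * t * t' * (v * (a * s')) + v * s * s' * (w * (b * t'))).
  by ring.
by rewrite -e -f; ring.
Qed.
Canonical pi_loc_add_morph := PiMorph2 pi_loc_add.

Lemma pi_loc_opp : {morph \pi_localization : x / ratio_opp x >-> loc_opp x}.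
Proof.
move=> x; unlock loc_opp; apply/eq_pi_locP => /=.
have [v Wv e] := repr_pi_locP x.
by exists v => //; rewrite !mulNr !mulrN e.
Qed.
Canonical pi_loc_opp_morph := PiMorph1 pi_loc_opp.

Lemma pi_loc_mul : {morph \pi_localization : x y / ratio_mul x y >-> loc_mul x y}.
Proof.
move=> x y; unlock loc_mul; apply/eq_pi_locP => /=.
have [v Wv] := repr_pi_locP x; have [w Ww] := repr_pi_locP y.
case: (repr (\pi_localization x)) (repr (\pi_localization y)) => [a' [s' ?]] [b' [t' ?]].
case: x y => [a [s ?]] [b [t ?]] /= f e.
exists (v * w); first exact: rpredM.
transitivity ((v * (a * s')) * (w * (b * t'))); first by ring.
by rewrite -e -f; ring.
Qed.
Canonical pi_loc_mul_morph := PiMorph2 pi_loc_mul.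

Lemma loc_addA : associative loc_add.
Proof.
elim/quotW=> x; elim/quotW=> y; elim/quotW=> z; rewrite !piE.
by apply/eq_pi_locP; exists 1; rewrite ?rpred1 //=; ring.
Qed.

Lemma loc_addC : commutative loc_add.
Proof.
elim/quotW=> x; elim/quotW=> y; rewrite !piE.
by apply/eq_pi_locP; exists 1; rewrite ?rpred1 //=; ring.
Qed.

Lemma loc_add0l : left_id loc0 loc_add.
Proof.
elim/quotW=> x; rewrite /loc0 !piE.
by apply/eq_pi_locP; exists 1; rewrite ?rpred1 //=; ring.
Qed.

Lemma loc_addNl : left_inverse loc0 loc_opp loc_add.
Proof.
elim/quotW=> x; rewrite /loc0 !piE.
by apply/eq_pi_locP; exists 1; rewrite ?rpred1 //=; ring.
Qed.

HB.instance Definition _ := GRing.isZmodule.Build localization loc_addA loc_addC loc_add0l loc_addNl.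

Lemma loc_mulA : associative loc_mul.
Proof.
elim/quotW=> x; elim/quotW=> y; elim/quotW=> z; rewrite !piE.
by apply/eq_pi_locP; exists 1; rewrite ?rpred1 //=; ring.
Qed.

Lemma loc_mulC : commutative loc_mul.
Proof.
elim/quotW=> x; elim/quotW=> y; rewrite !piE.
by apply/eq_pi_locP; exists 1; rewrite ?rpred1 //=; ring.
Qed.

Lemma loc_mul1l : left_id loc1 loc_mul.
Proof.
elim/quotW=> x; rewrite /loc1 !piE.
by apply/eq_pi_locP; exists 1; rewrite ?rpred1 //=; ring.
Qed.

Lemma loc_mulDl : left_distributive loc_mul loc_add.
Proof.
elim/quotW=> x; elim/quotW=> y; elim/quotW=> z; rewrite !piE.
by apply/eq_pi_locP; exists 1; rewrite ?rpred1 //=; ring.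
Qed.

HB.instance Definition _ :=
  GRing.Zmodule_isComPzRing.Build localization loc_mulA loc_mulC loc_mul1l loc_mulDl.

Definition toloc (r : R) : localization := \pi_localization (r, loc_denom1).

Lemma toloc_is_zmod_morphism : zmod_morphism toloc.
Proof.
move=> r s; rewrite /toloc -[X in _ = _ + X]pi_loc_opp -[RHS]pi_loc_add.
by apply/eq_pi_locP; exists 1; rewrite ?rpred1 //=; ring.
Qed.

HB.instance Definition _ :=
  GRing.isZmodMorphism.Build R localization toloc toloc_is_zmod_morphism.

Lemma toloc_is_monoid_morphism : monoid_morphism toloc.
Proof.
split=> [//|r s]; rewrite /toloc -[RHS]pi_loc_mul.
by apply/eq_pi_locP; exists 1; rewrite ?rpred1 //=; ring.
Qed.

HB.instance Definition _ :=
  GRing.isMonoidMorphism.Build R localization toloc toloc_is_monoid_morphism.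

End Localization.

(* Main.v *)
Require Import Defs.
From HB Require Import structures.
From mathcomp Require Import all_boot all_algebra.
From mathcomp Require Import boolp ring.

(** Let [W] be the smallest subset of [R] containing [1] and closed under
    products, divisors and non-nilpotent sums.  Primality of the nilradical keeps
    [W] away from the nilpotents.  A unit-additive [S] in which no non-nilpotent
    of [R] becomes nilpotent sees every element of [W] as a unit, by induction on
    membership in [W].  Since [W] is saturated, the units of the localization are
    the [a / s] with [a \in W], and the numerator of a sum of two of them is again
    a sum of two elements of [W]. *)

Set Implicit Arguments.
Unset Strict Implicit.
Unset Printing Implicit Defensive.

Import GRing.Theory.
Local Open Scope ring_scope.

(** * Units and nilpotents under products and ring morphisms *)

Section Units.

Variable R : comPzRingType.
Implicit Types x y z : R.

Lemma is_unit1 : is_unit (1 : R).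
Proof. by exists 1; rewrite mulr1. Qed.

Lemma is_unitMP x y : is_unit (x * y) <-> is_unit x /\ is_unit y.
Proof.
split=> [[z e]|[[x' ex] [y' ey]]].
  by split; [exists (y * z) | exists (x * z)]; rewrite -e; ring.
by exists (x' * y'); rewrite mulrACA ex ey mulr1.
Qed.

Lemma is_unit_mulIr x y z : is_unit z -> x * z = y * z -> x = y.
Proof.
by move=> [z' ez] e; rewrite -[x]mulr1 -[y]mulr1 -ez !mulrA e.
Qed.

Lemma is_unit_rmorph (S : comPzRingType) (f : {rmorphism R -> S}) x :
  is_unit x -> is_unit (f x).
Proof. by move=> [y e]; exists (f y); rewrite -rmorphM e rmorph1. Qed.

Lemma nilpotent_rmorph (S : comPzRingType) (f : {rmorphism R -> S}) x :
  nilpotent_elt x -> nilpotent_elt (f x).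
Proof. by move=> [n e]; exists n; rewrite -rmorphXn e rmorph0. Qed.

Lemma nilpotentMr x y : nilpotent_elt x -> nilpotent_elt (x * y).
Proof. by move=> [n e]; exists n; rewrite exprMn e mul0r. Qed.

Lemma nilpotentMr_unit x y :
  is_unit y -> nilpotent_elt (x * y) -> nilpotent_elt x.
Proof.
by move=> [y' e] nil_xy; rewrite -[x]mulr1 -e mulrA; apply: nilpotentMr.
Qed.

End Units.

(** * Fractions and the universal property of localization *)

Section LocalizationTheory.

Variables (R : comPzRingType) (W : mulrClosed R).

Lemma toloc_unit s : s \in W -> is_unit (toloc W s).
Proof.
move=> Ws; exists (\pi_(localization W)%qT (1, exist _ s Ws)).
rewrite -[LHS]pi_loc_mul; apply/eq_pi_locP.
by exists 1; rewrite ?rpred1 //=; ring.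
Qed.

Lemma toloc_eqP a b :
  toloc W a = toloc W b <-> exists2 w, w \in W & w * a = w * b.
Proof.
split=> [/eq_pi_locP[w Ww]|[w Ww e]]; first by rewrite /= !mulr1; exists w.
by apply/eq_pi_locP; exists w; rewrite //= !mulr1.
Qed.

(** This is [z = a / s] with the denominator cleared, so that later arguments compute in the ring
    without handling representatives of classes. *)
Lemma localization_fracP (z : localization W) :
  exists a s, s \in W /\ z * toloc W s = toloc W a.
Proof.
elim/quotW: z => -[a [s Ws]]; exists a, s; split=> //.
rewrite -[LHS]pi_loc_mul; apply/eq_pi_locP.
by exists 1; rewrite ?rpred1 //=; ring.
Qed.

(** Multiplying [z] by a denominator [s] moves it into the image of [R], and the unit
    [f (toloc W s)] can then be cancelled. *)
Lemma localization_rmorph_ext (S : comPzRingType)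
    (f g : {rmorphism localization W -> S}) :
  (forall r, f (toloc W r) = g (toloc W r)) -> f =1 g.
Proof.
move=> efg z; have [a [s [Ws e]]] := localization_fracP z.
apply: (is_unit_mulIr (is_unit_rmorph f (toloc_unit Ws))).
by rewrite -rmorphM e !efg -rmorphM e.
Qed.

Section UniversalProperty.

Variables (S : comPzRingType) (phi : {rmorphism R -> S}).
Hypothesis phiW : forall w, w \in W -> is_unit (phi w).

(** The value [phi a / phi s] is the same for all fractions [a / s] equal to [z]. Quantifying over
    all of them lets each ring law be checked on whichever fraction is convenient. *)
Lemma localization_value (z : localization W) :
  exists y, forall a s, s \in W -> z * toloc W s = toloc W a ->
    y * phi s = phi a.
Proof.
have [a0 [s0 [Ws0 e0]]] := localization_fracP z.
have [t et] := phiW Ws0; exists (phi a0 * t) => a s Ws e.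
have [w Ww ew] : exists2 w, w \in W & w * (a0 * s) = w * (a * s0).
  by apply/toloc_eqP; rewrite !rmorphM /= -e -e0 mulrAC.
(* The fractions cross-multiply to equal elements only up to the factor [w], which becomes a unit in
   [S]. *)
apply: (is_unit_mulIr (phiW Ws0)); apply: (is_unit_mulIr (phiW Ww)).
transitivity (phi (w * (a0 * s)) * (phi s0 * t)).
  by rewrite !rmorphM; ring.
by rewrite et ew !rmorphM; ring.
Qed.

Lemma localization_extension :
  exists phit : {rmorphism localization W -> S},
    forall r, phit (toloc W r) = phi r.
Proof.
have [f fP] := choice localization_value.
have fl r : f (toloc W r) = phi r.
  rewrite -[LHS]mulr1 -(rmorph1 phi); apply: fP; first exact: rpred1.
  by rewrite rmorph1 mulr1.
have fB : zmod_morphism f.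
  move=> x y; have [a [s [Ws ea]]] := localization_fracP x.
  have [b [t [Wt eb]]] := localization_fracP y.
  apply: (is_unit_mulIr (phiW (rpredM Ws Wt))).
  (* Here [x - y] is written as [(a * t - b * s) / (s * t)]. *)
  rewrite (fP _ (a * t - b * s)) ?rpredM //.
    by rewrite rmorphB !rmorphM -(fP _ _ _ Ws ea) -(fP _ _ _ Wt eb); ring.
  by rewrite rmorphB !rmorphM /= -ea -eb; ring.
have fM : monoid_morphism f.
  split=> [|x y]; first by rewrite -(rmorph1 (toloc W)) fl rmorph1.
  have [a [s [Ws ea]]] := localization_fracP x.
  have [b [t [Wt eb]]] := localization_fracP y.
  apply: (is_unit_mulIr (phiW (rpredM Ws Wt))).
  rewrite (fP _ (a * b)) ?rpredM //.
    by rewrite !rmorphM -(fP _ _ _ Ws ea) -(fP _ _ _ Wt eb); ring.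
  by rewrite !rmorphM /= -ea -eb; ring.
pose fBm := GRing.isZmodMorphism.Build _ _ f fB.
pose fMm := GRing.isMonoidMorphism.Build _ _ f fM.
pose phit : {rmorphism localization W -> S} := HB.pack f fBm fMm.
by exists phit.
Qed.

End UniversalProperty.

End LocalizationTheory.

(** * The multiplicative set and its localization *)

Section UnitAdditiveClosure.

Variable R : comPzRingType.

Inductive unit_additive_closure : R -> Prop :=
| uac_1 : unit_additive_closure 1
| uac_mul x y : unit_additive_closure x -> unit_additive_closure y ->
    unit_additive_closure (x * y)
| uac_div x y : unit_additive_closure (x * y) -> unit_additive_closure x
| uac_add x y : unit_additive_closure x -> unit_additive_closure y ->
    ~ nilpotent_elt (x + y) -> unit_additive_closure (x + y).

Definition uac_pred : {pred R} := fun x => `[< unit_additive_closure x >].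

Lemma uac_mulr_closed : mulr_closed uac_pred.
Proof.
split=> [|x y /asboolP Wx /asboolP Wy]; apply/asboolP; first exact: uac_1.
exact: uac_mul.
Qed.

HB.instance Definition _ := GRing.isMulClosed.Build R uac_pred uac_mulr_closed.

Lemma uac_not_nilpotent : prime_ideal (nilradical R) ->
  forall w, unit_additive_closure w -> ~ nilpotent_elt w.
Proof.
move=> [_ /asboolP nil1 primeM] w.
(* Properness of the nilradical settles [1], and the side condition of [uac_add] settles sums.
   Products need primality; a divisor is handled because multiples of nilpotents are nilpotent. *)
elim=> {w} // [x y _ nx _ ny /asboolP nxy | x y _ nxy nx].
  by case/orP: (primeM _ _ nxy) => /asboolP.
exact/nxy/nilpotentMr.
Qed.

Lemma uac_rmorph_unit (S : comPzRingType) (phi : {rmorphism R -> S}) :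
  unit_additive S ->
  (forall x, nilpotent_elt (phi x) -> nilpotent_elt x) ->
  forall w, unit_additive_closure w -> is_unit (phi w).
Proof.
move=> addS nil_phi w; elim=> {w}.
- by rewrite rmorph1; apply: is_unit1.
- by move=> x y _ ux _ uy; rewrite rmorphM; apply/is_unitMP.
- by move=> x y _; rewrite rmorphM => /is_unitMP[].
(* A nilpotent image of [x + y] would make [x + y] nilpotent, against [nxy]. *)
- move=> x y _ ux _ uy nxy; move: (addS _ _ ux uy).
  by rewrite -rmorphD => -[//|/nil_phi].
Qed.

(** If [b / s] is an inverse of [a], then [w * a * b = w * s] for some [w] in the closure, so [a]
    divides an element of the closure. *)
Lemma uac_toloc_unit a :
  is_unit (toloc uac_pred a) -> unit_additive_closure a.
Proof.
move=> [z ez]; have [b [s [Ws eb]]] := localization_fracP z.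
have [w /asboolP Ww ew] : exists2 w, w \in uac_pred & w * (a * b) = w * s.
  by apply/toloc_eqP; rewrite rmorphM /= -eb mulrA ez mul1r.
apply: (@uac_div a (b * w)); rewrite mulrA mulrC ew.
by apply: uac_mul => //; apply/asboolP.
Qed.

Lemma uac_localization_unit_additive : unit_additive (localization uac_pred).
Proof.
move=> u v uu uv; have [a [s [Ws ea]]] := localization_fracP u.
have [b [t [Wt eb]]] := localization_fracP v.
have us := toloc_unit Ws; have ut := toloc_unit Wt.
(* Over the common denominator [s * t], the numerators of [u] and [v] are [a * t] and [b * s], both
   units in the localization. *)
have Wat : unit_additive_closure (a * t).
  by apply: uac_toloc_unit; rewrite rmorphM /= -ea; do !(apply/is_unitMP; split).
have Wbs : unit_additive_closure (b * s).
  by apply: uac_toloc_unit; rewrite rmorphM /= -eb; do !(apply/is_unitMP; split).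
have e : (u + v) * toloc uac_pred (s * t) = toloc uac_pred (a * t + b * s).
  by rewrite rmorphD !rmorphM /= -ea -eb; ring.
have [nil_sum | nnil] := pselect (nilpotent_elt (a * t + b * s)); [right|left].
  apply: (nilpotentMr_unit (toloc_unit (rpredM Ws Wt))).
  by rewrite e; apply: nilpotent_rmorph.
suff /is_unitMP[] : is_unit ((u + v) * toloc uac_pred (s * t)) by [].
by rewrite e; apply: toloc_unit; apply/asboolP; apply: uac_add.
Qed.

End UnitAdditiveClosure.

Theorem theorem8p1 (R : comPzRingType) (primeN : prime_ideal (nilradical R)) :
  exists W : mulrClosed R,
    [/\ forall w, w \in W -> w \notin nilradical R,
        unit_additive (localization W)
      & forall (S : comPzRingType) (phi : {rmorphism R -> S}),
          unit_additive S ->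
          (forall x, phi x \in nilradical S -> x \in nilradical R) ->
          exists phit : {rmorphism localization W -> S},
            (forall r, phit (toloc W r) = phi r) /\
            (forall psi : {rmorphism localization W -> S},
               (forall r, psi (toloc W r) = phi r) ->
               forall z, psi z = phit z)].
Proof.
exists (@uac_pred R : mulrClosed R); split.
- by move=> w /asboolP Ww; apply/asboolP; apply: uac_not_nilpotent.
- exact: uac_localization_unit_additive.
move=> S phi addS nil_phi.
have phiW w : w \in @uac_pred R -> is_unit (phi w).
  move=> /asboolP; apply: uac_rmorph_unit => // x nx.
  exact/asboolP/nil_phi/asboolP.
have [phit phitE] := localization_extension phiW.
exists phit; split=> // psi psiE; apply: localization_rmorph_ext => r.
by rewrite psiE phitE.
Qed.
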